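(* Let $\mathcal{P}_A$ be an arrow space with arrow pre-inner product and scalar multiplication. For any $s,t\in\mathbb{R}$ and any arrow $\overrightarrow{AB}\in\mathcal{P}_A$, $(st)\overrightarrow{AB}=(s)\big((t)\overrightarrow{AB}\big)$; that is, arrow scalar multiplication is associative.
   Context: Let $\mathcal{P}$ be a set whose elements are called points. An arrow is an ordered pair of points $\overrightarrow{AB}=(A,B)$ (tail $A$, head $B$; $A=B$ is allowed). The arrow space $\mathcal{P}_A$ is the set of all arrows; two arrows are equal iff they have the same tail and the same head. Negation: $-\overrightarrow{AB}=\overrightarrow{BA}$. Arrow addition is the partial operation $\overrightarrow{AB}+_A\overrightarrow{BC}=\overrightarrow{AC}$, defined exactly when the head of the first arrow equals the tail of the second. Axiom 1: there is a given map (arrow pre-inner product) $\langle -,-\rangle_A:\mathcal{P}_A\times\mathcal{P}_A\to\mathbb{R}$ such that for all points: $\langle\overrightarrow{AB},\overrightarrow{AB}\rangle_A\ge 0$, with equality iff $A=B$; $\langle\overrightarrow{AB},\overrightarrow{CD}\rangle_A=\langle\overrightarrow{CD},\overrightarrow{AB}\rangle_A$; $\langle\overrightarrow{AB}+_A\overrightarrow{BC},\overrightarrow{LM}\rangle_A=\langle\overrightarrow{AB},\overrightarrow{LM}\rangle_A+\langle\overrightarrow{BC},\overrightarrow{LM}\rangle_A$; $\langle-\overrightarrow{AB},\overrightarrow{CD}\rangle_A=-\langle\overrightarrow{AB},\overrightarrow{CD}\rangle_A$. Measure: $\|\overrightarrow{AB}\|_A=\sqrt{\langle\overrightarrow{AB},\overrightarrow{AB}\rangle_A}$.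 Scalar multiplication: for $t\in\mathbb{R}$, if $A=B$ or $t=0$ then $(t)\overrightarrow{AB}=\overrightarrow{AA}$. If $A\ne B$ and $t\neq0$ then $(t)\overrightarrow{AB}=\overrightarrow{AD}$, where $D\in\mathcal{P}$ is a point (assumed to exist) with $\|\overrightarrow{AD}\|_A=|t|\,\|\overrightarrow{AB}\|_A$ and $\langle\overrightarrow{AB},\overrightarrow{AD}\rangle_A=\|\overrightarrow{AB}\|_A\|\overrightarrow{AD}\|_A$ if $t>0$, $=-\|\overrightarrow{AB}\|_A\|\overrightarrow{AD}\|_A$ if $t<0$. Axiom 2: $\langle(t)\overrightarrow{AB},\overrightarrow{CD}\rangle_A=t\langle\overrightarrow{AB},\overrightarrow{CD}\rangle_A$ for all arrows and all $t\in\mathbb{R}$. *)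

(* Defs.v *)
From Stdlib Require Import Reals.
Open Scope R_scope.

Set Implicit Arguments.

Definition arrow (P : Type) : Type := (P * P)%type.

Definition tail (P : Type) (a : arrow P) : P := fst a.
Definition head (P : Type) (a : arrow P) : P := snd a.

Definition arrow_opp (P : Type) (a : arrow P) : arrow P := (head a, tail a).

(* Addition is partial: the last argument is the proof that the sum is
   defined. *)
Definition arrow_add (P : Type) (a b : arrow P) (_ : head a = tail b) :
  arrow P := (tail a, head b).

Record arrow_preinner (P : Type) (ip : arrow P -> arrow P -> R) : Prop := {
  preinner_ge0 : forall A B : P, 0 <= ip (A, B) (A, B);
  preinner_eq0 : forall A B : P, ip (A, B) (A, B) = 0 <-> A = B;
  preinner_sym : forall a b : arrow P, ip a b = ip b a;
  preinner_add : forall (a b c : arrow P) (hab : head a = tail b),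
    ip (arrow_add a b hab) c = ip a c + ip b c;
  preinner_opp : forall a b : arrow P, ip (arrow_opp a) b = - ip a b
}.

Definition arrow_norm (P : Type) (ip : arrow P -> arrow P -> R)
  (a : arrow P) : R := sqrt (ip a a).

(* The existence of the point D is part of the definition of a scalar
   multiplication.  No uniqueness of D is required: smul may be any function
   selecting such a point. *)
Record arrow_scalar_mul (P : Type) (ip : arrow P -> arrow P -> R)
  (smul : R -> arrow P -> arrow P) : Prop := {
  scalar_mul_degenerate : forall (t : R) (A B : P),
    A = B \/ t = 0 -> smul t (A, B) = (A, A);
  scalar_mul_generic : forall (t : R) (A B : P),
    A <> B -> t <> 0 ->
    exists D : P,
      smul t (A, B) = (A, D) /\
      arrow_norm ip (A, D) = Rabs t * arrow_norm ip (A, B) /\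
      (0 < t ->
       ip (A, B) (A, D) = arrow_norm ip (A, B) * arrow_norm ip (A, D)) /\
      (t < 0 ->
       ip (A, B) (A, D) = - (arrow_norm ip (A, B) * arrow_norm ip (A, D)))
}.

Definition preinner_homogeneous (P : Type) (ip : arrow P -> arrow P -> R)
  (smul : R -> arrow P -> arrow P) : Prop :=
  forall (t : R) (a b : arrow P), ip (smul t a) b = t * ip a b.

(* Main.v *)
(* Two arrows with a common tail that pair equally with every arrow are equal:
   if [A -> D] and [A -> E] do, then [E -> D = (E -> A) + (A -> D)] pairs to zero
   with itself.  Both sides of the associativity law have the tail of [a] and,
   by homogeneity, pair with any [c] to [s * t * ip a c]. *)
Require Import Defs.
From Stdlib Require Import Reals Lra.
Open Scope R_scope.

Lemma preinner_separates_heads (P : Type) (ip : arrow P -> arrow P -> R)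
  (ip_preinner : arrow_preinner ip) (a b : arrow P) :
  tail a = tail b -> (forall c : arrow P, ip a c = ip b c) -> a = b.
Proof.
  destruct a as [A D], b as [A' E]; cbn; intros <- Hip.
  assert (H0 : ip (E, D) (E, D) = 0).
  (* Only the left argument is split; the right one stays [(E, D)] and is the [c] at which [Hip]
     makes the two terms cancel. *)
  { change (E, D) with (arrow_add (arrow_opp (A, E)) (A, D) eq_refl) at 1.
    rewrite (preinner_add ip_preinner), (preinner_opp ip_preinner), Hip.
    lra. }
  apply (preinner_eq0 ip_preinner) in H0.
  now rewrite H0.
Qed.

(** Pairings alone do not determine a tail, since every [(A, A)] pairs to zero with all arrows. The
    tail is instead read off the definition of [smul], each case of which returns an arrow from
    [A]. *)
Lemma tail_scalar_mul (P : Type) (ip : arrow P -> arrow P -> R)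
  (smul : R -> arrow P -> arrow P)
  (ip_preinner : arrow_preinner ip) (smul_scalar : arrow_scalar_mul ip smul)
  (t : R) (a : arrow P) :
  tail (smul t a) = tail a.
Proof.
  destruct a as [A B].
  destruct (Req_dec t 0) as [Ht | Ht].
  { now rewrite (scalar_mul_degenerate smul_scalar) by now right. }
  (* Equality on [P] is decided through the real number [ip (A, B) (A, B)]. *)
  destruct (Req_dec (ip (A, B) (A, B)) 0) as [HAB | HAB];
    rewrite (preinner_eq0 ip_preinner) in HAB.
  - now rewrite (scalar_mul_degenerate smul_scalar) by now left.
  - now destruct (scalar_mul_generic smul_scalar HAB Ht) as [D [-> _]].
Qed.

Theorem theorem22 (P : Type)
  (ip : arrow P -> arrow P -> R)
  (smul : R -> arrow P -> arrow P)
  (ip_preinner : arrow_preinner ip)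
  (smul_scalar : arrow_scalar_mul ip smul)
  (ip_homogeneous : preinner_homogeneous ip smul)
  (s t : R) (a : arrow P) :
  smul (s * t) a = smul s (smul t a).
Proof.
  apply (preinner_separates_heads P ip ip_preinner).
  - now rewrite !(tail_scalar_mul P ip smul ip_preinner smul_scalar).
  - intros c. rewrite !ip_homogeneous. ring.
Qed.
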